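(* Let $A$ be an integrally closed local domain with quotient field $L$, let $\widetilde{\mathfrak m}$ be a maximal ideal of the integral closure $I(A)$ of $A$ in the separable-algebraic closure $L^{\mathrm{sep}}$ of $L$, and let $F$ be a finite extension of $L$ contained in the absolute inertia field of $L$ with respect to $\widetilde{\mathfrak m}$. Let $A^*=F\cap I(A)$ be the integral closure of $A$ in $F$ and $B=A^*_{\widetilde{\mathfrak m}\cap A^*}$. Then there is $\eta\in B$ such that $F=L(\eta)$, the (monic) minimal polynomial $h(X)$ of $\eta$ over $L$ lies in $A[X]$, and $\eta$ and $h'(\eta)$ are units in $B$. In particular, $\eta$ is a henselian element over $A$.
   Context: The absolute inertia field of $L$ with respect to $\widetilde{\mathfrak m}$ is the subfield of $L^{\mathrm{sep}}$ of all elements fixed by the group $\{\sigma\in\mathrm{Gal}(L^{\mathrm{sep}}|L)\mid \forall x\in I(A):\ x-\sigma(x)\in\widetilde{\mathfrak m}\}$. For an extension $A\subseteq B$ of commutative rings with unity, an element $b\in B$ is called a henselian element over $A$ if there is a polynomial $h(X)\in A[X]$ (not necessarily monic) such that $h(b)=0$ and $h'(b)$ is a unit of $B$. Rings are not assumed Noetherian. *)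

(* Defs.v *)
From HB Require Import structures.
From mathcomp Require Import all_boot all_order all_algebra all_field.
From mathcomp Require Import boolp classical_sets.

Set Implicit Arguments.
Unset Strict Implicit.
Unset Printing Implicit Defensive.

Import GRing.Theory.

Local Open Scope classical_set_scope.
Local Open Scope ring_scope.

Section Rings.
Variable R : comNzRingType.

(* In the following three definitions S is a subring (with 1) of R, regarded
   as a ring in its own right. *)
Definition ideal_of (S I : set R) : Prop :=
  [/\ I `<=` S, I 0, (forall x y, I x -> I y -> I (x + y))
    & (forall a x, S a -> I x -> I (a * x))].

Definition maximal_ideal_of (S I : set R) : Prop :=
  [/\ ideal_of S I, I <> S
    & (forall J, ideal_of S J -> J <> S -> I `<=` J -> J = I)].

Definition unit_of (S : set R) (x : R) : Prop :=
  S x /\ exists2 y, S y & x * y = 1.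

Definition local_ring : Prop :=
  exists! I : set R, maximal_ideal_of [set: R] I.

End Rings.

(* The ring extension is A -> B, where B is a subring of R containing the
   image of f; the polynomial p need not be monic. *)
Definition henselian_element (A R : comNzRingType) (f : {rmorphism A -> R})
    (B : set R) (b : R) : Prop :=
  B b /\ exists p : {poly A},
    root (map_poly f p) b /\ unit_of B (map_poly f p)^`().[b].

Definition quotient_field (A : idomainType) (L : fieldType)
    (f : {rmorphism A -> L}) : Prop :=
  injective f /\
  forall x : L, exists a b : A, b != 0 /\ x = f a / f b.

Definition integrally_closed (A : idomainType) (L : fieldType)
    (f : {rmorphism A -> L}) : Prop :=
  forall x : L, integralOver f x -> exists a : A, x = f a.

(* p is the minimal polynomial of x: monic, irreducible, with root x. *)
Definition separable_algebraic (L K : fieldType) (f : {rmorphism L -> K})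
    (x : K) : Prop :=
  exists p : {poly L},
    [/\ p \is monic, irreducible_poly p, root (map_poly f p) x
      & separable_poly p].

Definition separably_closed (K : fieldType) : Prop :=
  forall p : {poly K}, (1 < size p)%N -> separable_poly p ->
    exists x : K, root p x.

Definition separable_closure (L K : fieldType) (f : {rmorphism L -> K}) : Prop :=
  (forall x : K, separable_algebraic f x) /\ separably_closed K.

Definition integral_closure (A : idomainType) (K : fieldType)
    (f : {rmorphism A -> K}) : set K :=
  [set x | integralOver f x].

(* Gal(K|L), for K an extension of L through f. *)
Definition galois_group (L K : fieldType) (f : {rmorphism L -> K})
    (s : {rmorphism K -> K}) : Prop :=
  bijective s /\ forall a : L, s (f a) = f a.

Section Inertia.
Variables (A : idomainType) (L K : fieldType).
Variables (iA : {rmorphism A -> L}) (iL : {rmorphism L -> K}) (m : set K).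

Definition absolute_inertia_group (s : {rmorphism K -> K}) : Prop :=
  galois_group iL s /\
  forall x, integral_closure (iL \o iA) x -> m (x - s x).

Definition absolute_inertia_field : set K :=
  [set y | forall s : {rmorphism K -> K}, absolute_inertia_group s -> s y = y].

End Inertia.

Section Localization.
Variables (A : idomainType) (F K : fieldType).
Variables (iA : {rmorphism A -> K}) (j : {rmorphism F -> K}) (m : set K).

(* F ∩ I(A), for F regarded as a subfield of K through j. *)
Definition trace_integral_closure : set F := j @^-1` integral_closure iA.

(* The localization of F ∩ I(A) at its prime ideal m ∩ F, as a subring of F.
   When m is an ideal it contains 0, so the denominators s are nonzero. *)
Definition localization_at_trace : set F :=
  [set x | exists a s : F,
    [/\ trace_integral_closure a, trace_integral_closure s, ~ m (j s)
      & x = a / s]].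

End Localization.

(* Main.v *)
(* Let C be the integral closure of A in F and kappa the residue field of I(A) at m.
   If an L-embedding sigma of F into L^sep is congruent to the inclusion j modulo m on
   C, then sigma extends to an element of the inertia group, hence sigma = j.  For the
   extension, Zorn's lemma reduces to adjoining one element a to a field E on which a
   homomorphism tau congruent to the identity is given; the conjugate b to which a
   must be sent is found by reducing modulo m the characteristic polynomial of a
   generic element of E(a) /\ I(A) and its image under tau.

   So j and the finitely many other embeddings of F induce homomorphisms phi_0 and
   phi_i from C to kappa with phi_i <> phi_0, and it remains to find eta in C with
   phi_0 eta <> 0 and phi_i eta <> phi_0 eta for all i: then eta differs modulo m from
   all its other conjugates, so that eta generates F and h'(eta), the product of the
   differences, is not in m. *)

Require Import Defs.
From HB Require Import structures.
From mathcomp Require Import all_boot all_order all_algebra all_field.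
From mathcomp Require Import boolp classical_sets.
From mathcomp Require Import perm cyclic mpoly.

Set Implicit Arguments.
Unset Strict Implicit.
Unset Printing Implicit Defensive.

Import GRing.Theory.

Local Open Scope classical_set_scope.
Local Open Scope ring_scope.

(** * Symmetric functions of roots *)

Lemma mmap_meval (n : nat) (R S : comNzRingType) (phi : {rmorphism R -> S})
    (c : 'I_n -> R) (t : {mpoly R[n]}) :
  mmap phi (phi \o c) t = phi t.@[c].
Proof.
rewrite mevalE rmorph_sum /=; apply: eq_bigr => i _.
by rewrite rmorphM rmorph_prod; congr (_ * _); apply: eq_bigr => k _; rewrite rmorphXn.
Qed.

Lemma mmap_comp_mpoly (n : nat) (R S : comNzRingType) (phi : {rmorphism R -> S})
    (h : 'I_n -> S) (s : n.-tuple {mpoly R[n]}) (t : {mpoly R[n]}) :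
  mmap phi h (t \mPo s) = mmap phi (fun i => mmap phi h (tnth s i)) t.
Proof.
rewrite comp_mpolyEX rmorph_sum /=; apply: eq_bigr => i _.
rewrite mmapZ comp_mpolyX rmorph_prod; congr (_ * _).
by apply: eq_bigr => k _; rewrite rmorphXn.
Qed.

(* P comes before phi because two embeddings of one field of coefficients must share it. *)
Lemma prod_horner_roots (R : comNzRingType) (f Q : {poly R}) : f \is monic ->
  exists P : R, forall (S : idomainType) (phi : {rmorphism R -> S}) (rs : seq S),
    map_poly phi f = \prod_(x <- rs) ('X - x%:P) ->
    \prod_(x <- rs) (map_poly phi Q).[x] = phi P.
Proof.
move=> f_monic; pose n := (size f).-1.
(* At the roots of [f], in whatever [S], this polynomial takes the value of the desired product.
   Being symmetric, it is a polynomial [t] in the elementary symmetric functions, and [t] is then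
   evaluated inside [R]. *)
pose p : {mpoly R[n]} := \prod_(i < n) (map_poly (mpolyC n (R:=R)) Q).['X_i].
have symp : p \is symmetric.
  apply/issymP => s; rewrite /p rmorph_prod /=.
  rewrite [RHS](reindex_inj (@perm_inj _ s)) /=.
  apply: eq_bigr => i _; rewrite -horner_map /= -map_poly_comp /=; congr (_.[_]).
    by apply: eq_map_poly => c /=; rewrite /msym mmapC.
  by rewrite /msym mmapX mmap1U.
have [t [tE _]] := sym_fundamental symp.
(* By Vieta, the elementary symmetric function of degree [i.+1] at the roots; the shift is there
   because ['I_n] starts at 0. *)
pose c (i : 'I_n) : R := (-1) ^+ i.+1 * f`_(n - i.+1).
exists t.@[c] => S phi rs fE.
have szrs : size rs == n.
  apply/eqP; rewrite /n -(size_map_poly_id0 (f := phi)) ?fE ?size_prod_XsubC //.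
  by rewrite (eqP f_monic) rmorph1 oner_neq0.
pose rt := Tuple szrs.
transitivity (mmap phi (tnth rt) p).
  rewrite /p rmorph_prod /= (big_tuple _ _ rt) /=.
  apply: eq_bigr => i _; rewrite -horner_map /= -map_poly_comp /=; congr (_.[_]).
    by apply: eq_map_poly => a /=; rewrite mmapC.
  by rewrite mmapX mmap1U.
rewrite -tE mmap_comp_mpoly -mmap_meval; apply: eq_bigr => k _.
congr (_ * _); apply: mmap1_eq => i /=.
have := mroots_coeff rt (lift ord0 i).
rewrite /= -fE coef_map rmorphM rmorphXn rmorphN1 => ->.
rewrite /bump /= add1n mulrA -exprMn mulrNN mulr1 expr1n mul1r tnth_mktuple.
rewrite /mesym /meval !raddf_sum /=; apply: eq_bigr => h _.
rewrite !rmorph_prod /=; apply: eq_bigr => l _.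
by rewrite mmapX mmap1U mmapX mmap1U.
Qed.

(** * The integral closure as a ring *)

Section IntegralClosureRing.
Variables (A : comNzRingType) (K : fieldType) (f : {rmorphism A -> K}).

Definition integral_elt : {pred K} := [pred x | `[< integralOver f x >]].

Lemma integral_eltP x : reflect (integralOver f x) (x \in integral_elt).
Proof. exact: asboolP. Qed.

Fact integral_elt_subring : subring_closed integral_elt.
Proof.
split=> [|x y /integral_eltP fx /integral_eltP fy|x y /integral_eltP fx /integral_eltP fy];
  apply/integral_eltP; [exact: integral1|exact: integral_sub|exact: integral_mul].
Qed.
HB.instance Definition _ :=
  GRing.isSubringClosed.Build K integral_elt integral_elt_subring.

(** A ring type instead of a subset of [K]: reductions are bundled morphisms with this source, and
    the symmetric function argument takes polynomials over it. *)
Record integral_ring := IntegralElt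
  { integral_val : K; integral_valP : integral_val \in integral_elt }.
HB.instance Definition _ := [isSub for integral_val].
HB.instance Definition _ := [Choice of integral_ring by <:].
HB.instance Definition _ := [SubChoice_isSubComNzRing of integral_ring by <:].

End IntegralClosureRing.

(** * Extending homomorphisms congruent to the identity *)

Section ConjugateCongruence.
Variables (A I : comNzRingType) (K kappa : fieldType).
Variables (iK : {rmorphism A -> K}) (v : {rmorphism I -> K}).
Variable (red : {rmorphism I -> kappa}).
Hypothesis v_inj : injective v.
Hypothesis v_int : forall u, integralOver iK (v u).
Hypothesis v_surj : forall z, integralOver iK z -> exists u, v u = z.
Variables (E : fieldType) (iE : {rmorphism A -> E}) (iota tau : {rmorphism E -> K}).
Hypothesis iotaA : forall a, iota (iE a) = iK a.
Hypothesis tauA : forall a, tau (iE a) = iK a.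
Hypothesis iota_tau : forall (x : E) (u w : I),
  v u = iota x -> v w = tau x -> red u = red w.
Variables (f : {poly E}) (rs rs' : seq K) (a : K).
Hypothesis f_monic : f \is monic.
Hypothesis f_iota : map_poly iota f = \prod_(x <- rs) ('X - x%:P).
Hypothesis f_tau : map_poly tau f = \prod_(x <- rs') ('X - x%:P).
Hypothesis a_rs : a \in rs.
Hypothesis f_min : forall p : {poly E}, root (map_poly iota p) a -> f %| p.

(** An integral equation for q(a) gives a polynomial over [E] vanishing at [a], hence a multiple of
    [f]; it therefore vanishes at every root of the image of [f] under [sigma] as well. *)
Lemma integral_conjugate (sigma : {rmorphism E -> K}) (q : {poly E}) (x : K) :
    (forall c, sigma (iE c) = iK c) -> root (map_poly sigma f) x ->
    integralOver iK (map_poly iota q).[a] ->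
  integralOver iK (map_poly sigma q).[x].
Proof.
move=> sigmaA fx [p p_monic pq0]; exists p => //.
have: f %| map_poly iE p \Po q.
  apply: f_min; rewrite map_comp_poly -map_poly_comp /root horner_comp.
  by rewrite (eq_map_poly (g := iK)).
case/dvdpP=> g /(congr1 (fun r => (map_poly sigma r).[x])).
rewrite rmorphM hornerM (rootP fx) mulr0 map_comp_poly -map_poly_comp horner_comp.
by rewrite (eq_map_poly (g := iK)) // => /rootP.
Qed.

(* The symmetric functions of the conjugates of X = sum_i q_i(a) T^i have
   coefficients in E, hence the same reduction under iota and under tau; so X is
   congruent to one of the conjugates on the tau side.  The indeterminate T makes a
   single conjugate work for all the q_i. *)
Lemma congruent_conjugate_family (n : nat) (q : nat -> {poly E}) :
    (forall i, (i < n)%N -> integralOver iK (map_poly iota (q i)).[a]) ->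
  exists2 b, b \in rs' & forall i u w, (i < n)%N ->
    v u = (map_poly iota (q i)).[a] -> v w = (map_poly tau (q i)).[b] ->
    red u = red w.
Proof.
move=> q_int.
(* Outside the integral closure the value of [lift] is arbitrary; [liftK] is only applied to
   integral elements. *)
have /choice[lift liftK] : forall z, exists u, integralOver iK z -> v u = z.
  move=> z; have [/v_surj[u <-]|nz] := pselect (integralOver iK z); first by exists u.
  by exists 0.
pose X (sigma : {rmorphism E -> K}) (x : K) : {poly I} :=
  \poly_(i < n) lift (map_poly sigma (q i)).[x].
pose cst := polyC \o @polyC E.
(* From the inside out, the variables are T, Y and the one evaluated at a root x, so that Q(x) = Y -
   sum_i q_i(x) T^i. The product over the roots is the characteristic polynomial of X in Y, with
   coefficients in E[T]. *)
pose Q : {poly {poly {poly E}}} :=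
  'X%:P - \sum_(i < n) ('X^i)%:P *: map_poly cst (q i).
have [P PE] := prod_horner_roots Q (monic_map cst f_monic).
have {}PE (sigma : {rmorphism E -> K}) (s : seq K) :
    (forall c, sigma (iE c) = iK c) ->
    map_poly sigma f = \prod_(x <- s) ('X - x%:P) ->
  map_poly (map_poly v) (\prod_(x <- s) ('X - (X sigma x)%:P)) =
    map_poly (map_poly sigma) P.
  move=> sigmaA sigma_f.
  rewrite -(PE _ (map_poly (map_poly sigma)) (map (polyC \o @polyC K) s)).
    rewrite big_map rmorph_prod /= !big_seq; apply: eq_bigr => x sx.
    rewrite !rmorphB /= !map_polyC /= !map_polyX hornerD hornerC hornerN.
    congr (_ - _).
    rewrite rmorph_sum horner_sum /X poly_def !rmorph_sum /=; apply: eq_bigr => i _.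
    have sigma_int : integralOver iK (map_poly sigma (q i)).[x].
      apply: integral_conjugate => //; last exact: q_int.
      by rewrite sigma_f root_prod_XsubC.
    rewrite map_polyZ map_polyXn /= liftK // map_polyZ hornerZ /=.
    rewrite map_polyC /= map_polyXn -map_poly_comp.
    rewrite (eq_map_poly (g := (polyC \o polyC) \o sigma)); last first.
      by move=> c /=; rewrite map_polyC /= map_polyC.
    rewrite map_poly_comp (horner_map (polyC \o polyC)) /=.
    by rewrite -polyCM mulrC mul_polyC.
  rewrite -map_poly_comp big_map (eq_map_poly (g := (polyC \o polyC) \o sigma)).
    rewrite map_poly_comp sigma_f rmorph_prod /=; apply: eq_bigr => x _.
    by rewrite rmorphB /= map_polyX map_polyC.
  by move=> c /=; rewrite map_polyC /= map_polyC.
(* Corresponding coefficients of the two products are the images under [iota] and [tau] of one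
   coefficient of [P], so [iota_tau] applies. *)
have redE : map_poly (map_poly red) (\prod_(x <- rs) ('X - (X iota x)%:P)) =
            map_poly (map_poly red) (\prod_(x <- rs') ('X - (X tau x)%:P)).
  apply/polyP => k; apply/polyP => l; rewrite !coef_map.
  by apply: (iota_tau (x := P`_k`_l)); rewrite -!coef_map PE // !coef_map.
(* The reduction of X at [a] is a root of the reduced product; on the [tau] side this is a product
   of linear factors over the domain kappa[T], one of which must vanish. *)
have: (map_poly (map_poly red) (\prod_(x <- rs) ('X - (X iota x)%:P))).[
         map_poly red (X iota a)] = 0.
  rewrite horner_map horner_prod (big_rem a) //= hornerXsubC subrr mul0r.
  by rewrite rmorph0.
rewrite redE horner_map horner_prod rmorph_prod /= => /eqP.
rewrite prodf_seq_eq0 => /hasP[b rs'b /=].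
rewrite hornerXsubC rmorphB subr_eq0 => /eqP XE.
exists b => // i u w lt_in uE wE.
have := congr1 (fun p : {poly kappa} => p`_i) XE.
rewrite !coef_map !coef_poly lt_in.
have <- : u = lift (map_poly iota (q i)).[a].
  by apply: v_inj; rewrite liftK //; apply: q_int.
have <- // : w = lift (map_poly tau (q i)).[b].
apply: v_inj; rewrite liftK //.
apply: integral_conjugate => //; last exact: q_int.
by rewrite f_tau root_prod_XsubC.
Qed.

(** If every [b] in [rs'] had a counterexample q_b, the finite family of all q_b would still have a
    common congruent conjugate [b], contradicting the choice of q_b. Each q_b(a) is integral because
    a counterexample includes a preimage of it under [v]. *)
Lemma congruent_conjugate : exists2 b, b \in rs' & forall (q : {poly E}) u w,
  v u = (map_poly iota q).[a] -> v w = (map_poly tau q).[b] -> red u = red w.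
Proof.
apply: contrapT => no_b.
have {}no_b b : exists q : {poly E}, b \in rs' -> exists u w,
    [/\ v u = (map_poly iota q).[a], v w = (map_poly tau q).[b] & red u <> red w].
  have [rs'b|nrs'b] := boolP (b \in rs'); last by exists 0.
  apply: contrapT => no_q; apply: no_b; exists b => // q u w uE wE.
  by apply: contrapT => uw; apply: no_q; exists q => _; exists u, w.
have /choice[q qP] := no_b.
have [i lt_i|b rs'b congr_b] :=
    @congruent_conjugate_family (size rs') (fun i => q (nth 0 rs' i)).
  by have [u [_ [<- _ _]]] := qP _ (mem_nth 0 lt_i); apply: v_int.
have [u [w [uE wE]]] := qP b rs'b; apply.
have lt_b : (index b rs' < size rs')%N by rewrite index_mem.
by apply: (congr_b _ u w lt_b); rewrite nth_index.
Qed.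

End ConjugateCongruence.

Lemma separable_splits (K : fieldType) (p : {poly K}) :
    separably_closed K -> p \is monic -> separable_poly p ->
  exists rs : seq K, p = \prod_(x <- rs) ('X - x%:P).
Proof.
move=> K_closed; have [n] := ubnP (size p); elim: n => // n IHn in p *.
rewrite ltnS => le_p_n p_monic p_sep.
have [p_gt1|p_le1] := ltnP 1%N (size p); last first.
  exists [::]; rewrite big_nil; move: p_monic.
  by rewrite (size1_polyC p_le1) monicE lead_coefC => /eqP->.
have [x /factor_theorem[q pE]] := K_closed p p_gt1 p_sep.
have q_monic : q \is monic by rewrite -(monicMr q (monicXsubC x)) -pE.
have q_sep : separable_poly q by apply: dvdp_separable p_sep; rewrite pE dvdp_mulr.
have [|rs qE] := IHn q _ q_monic q_sep.
  by rewrite pE size_Mmonic ?monicXsubC ?monic_neq0 // size_XsubC addn2 in le_p_n.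
by exists (x :: rs); rewrite big_cons pE -qE mulrC.
Qed.

(** A nonzero annihilator of least degree, made monic, divides all others, since a nonzero remainder
    would be a smaller annihilator. *)
Lemma minimal_annihilator (E K : fieldType) (iota : {rmorphism E -> K})
    (a : K) (p : {poly E}) : p != 0 -> root (map_poly iota p) a ->
  exists f : {poly E}, [/\ f \is monic, root (map_poly iota f) a &
    forall q, root (map_poly iota q) a -> f %| q].
Proof.
move=> p_neq0 pa.
pose P n := `[< exists q : {poly E}, [/\ q != 0, size q = n & root (map_poly iota q) a] >].
have exP : exists n, P n by exists (size p); apply/asboolP; exists p.
have [m /asboolP[g [g_neq0 <- ga]] g_min] := ex_minnP exP.
have lead_g : lead_coef g != 0 by rewrite lead_coef_eq0.
exists ((lead_coef g)^-1 *: g); split.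
- by rewrite monicE lead_coefZ mulVf.
- by rewrite map_polyZ /root hornerZ (rootP ga) mulr0.
move=> q qa; rewrite dvdpZl ?invr_eq0 // /dvdp; apply: contraT => r_neq0.
have /g_min : P (size (q %% g)).
  apply/asboolP; exists (q %% g); split=> //.
  have /(congr1 (fun r => (map_poly iota r).[a])) := divp_eq q g.
  rewrite rmorphD rmorphM hornerD hornerM (rootP ga) (rootP qa) mulr0 add0r.
  by move/esym/rootP.
by rewrite leqNgt ltn_modp g_neq0.
Qed.

(** * Graphs of partial homomorphisms and their maximal extension *)

Section Graphs.
Variables (A : idomainType) (I : comNzRingType) (L K kappa : fieldType).
Variables (iA : {rmorphism A -> L}) (iL : {rmorphism L -> K}).
Variables (v : {rmorphism I -> K}) (red : {rmorphism I -> kappa}).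
Hypothesis v_inj : injective v.
Hypothesis v_int : forall u, integralOver (iL \o iA) (v u).
Hypothesis v_surj : forall z, integralOver (iL \o iA) z -> exists u, v u = z.
Hypothesis K_sep : separable_closure iL.

(* Partial L-homomorphisms of K congruent to the identity, seen as subrings of the
   product ring K * K. *)
Record congruence_graph (G : set (K * K)) : Prop := CongruenceGraph {
  graphB : forall p q, G p -> G q -> G (p - q);
  graphM : forall p q, G p -> G q -> G (p * q);
  graph_base : forall c, G (iL c, iL c);
  graph_functional : forall p, G p -> p.1 = 0 -> p.2 = 0;
  graph_congr : forall p u w, G p -> v u = p.1 -> v w = p.2 -> red u = red w
}.

Section GraphField.
Variables (G : set (K * K)) (gG : congruence_graph G).

Let graph_mem : {pred K * K} := [pred p | `[< G p >]].

Fact graph_mem_subring : subring_closed graph_mem.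
Proof.
split=> [|p q /asboolP Gp /asboolP Gq|p q /asboolP Gp /asboolP Gq]; apply/asboolP.
- by have := graph_base gG 1; rewrite rmorph1.
- exact: graphB.
- exact: graphM.
Qed.
HB.instance Definition _ :=
  GRing.isSubringClosed.Build (K * K)%type graph_mem graph_mem_subring.

Record graph_elt := GraphElt { graph_val : K * K; _ : graph_val \in graph_mem }.
HB.instance Definition _ := [isSub for graph_val].
HB.instance Definition _ := [Choice of graph_elt by <:].
HB.instance Definition _ := [SubChoice_isSubComNzRing of graph_elt by <:].

Lemma graph_poly p (q : {poly L}) :
  G p -> G ((map_poly iL q).[p.1], (map_poly iL q).[p.2]).
Proof.
move=> Gp; elim/poly_ind: q => [|q c IHq].
  by have := graph_base gG 0; rewrite !rmorph0 !horner0.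
rewrite rmorphD rmorphM /= map_polyX map_polyC /= !hornerMXaddC.
have G0 : G 0 by have := graph_base gG 0; rewrite !rmorph0.
have GN r : G r -> G (- r) by rewrite -[- r]add0r; apply: graphB.
have := graphB gG (graphM gG IHq Gp) (GN _ (graph_base gG c)).
by rewrite opprK; case: p {Gp IHq} => x y.
Qed.

(** Powers of the variable are split off from a polynomial annihilating [x] until its constant term
    c is nonzero; from x q(x) + c = 0 the inverse can be read off. Hence a subring of [K] containing
    [L] is a field. *)
Lemma poly_inverse (x : K) : x != 0 -> exists q : {poly L}, x * (map_poly iL q).[x] = 1.
Proof.
move=> x_neq0; have [p [p_monic _ px _]] := K_sep.1 x.
have p_neq0 := monic_neq0 p_monic.
have [k [r /implyP/(_ p_neq0) r0 pE]] := multiplicity_XsubC p 0.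
have rx : root (map_poly iL r) x.
  move: px; rewrite /root pE rmorphM rmorphXn rmorphB /= map_polyX map_polyC /= rmorph0.
  by rewrite hornerM horner_exp hornerXsubC subr0 mulf_eq0 expf_eq0 (negPf x_neq0) andbF orbF.
have [q [c rE]] : exists q c, r = q * 'X + c%:P.
  elim/poly_ind: r {r0 pE rx} => [|q c _]; last by exists q, c.
  by exists 0, 0; rewrite mul0r addr0.
have c_neq0 : iL c != 0.
  by move: r0; rewrite fmorph_eq0 /root rE hornerMXaddC mulr0 add0r.
exists (- c^-1 *: q).
move: rx; rewrite /root rE rmorphD rmorphM /= map_polyX map_polyC hornerMXaddC /=.
rewrite addr_eq0 => /eqP qx.
rewrite map_polyZ hornerZ mulrCA [x * _]mulrC qx rmorphN fmorphV mulrNN.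
by rewrite mulVf.
Qed.

(** If q(p.1) inverts the first component, then p q(p) - 1 is a pair of the graph with first
    component 0, so its second component is 0 too. *)
Lemma graph_eltV (x : graph_elt) : exists y, x != 0 -> y * x = 1.
Proof.
have [->|x_neq0] := eqVneq x 0; first by exists 0.
case: x x_neq0 => p p_mem x_neq0; have Gp : G p by apply/asboolP.
have p1_neq0 : p.1 != 0.
  apply: contra_neq x_neq0 => p1_eq0; apply: val_inj => /=.
  by case: p {p_mem} Gp p1_eq0 => x y Gp /= x0; have /= -> := graph_functional gG Gp x0; rewrite x0.
have [q qE] := poly_inverse p1_neq0.
have Gq := graph_poly q Gp.
have /asboolP q_mem := Gq.
exists (GraphElt q_mem) => _; apply: val_inj => /=.
have G1 := graph_base gG 1.
have := graph_functional gG (graphB gG (graphM gG Gp Gq) G1).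
rewrite /= qE rmorph1 subrr => /(_ erefl) /eqP; rewrite subr_eq0 => /eqP qE2.
by case: p {x_neq0 p_mem p1_neq0 Gp Gq G1 q_mem} qE qE2 => x y /= qE qE2; congr pair;
  rewrite mulrC.
Qed.

Let graph_inv x : graph_elt := if x == 0 then 0 else projT1 (choice graph_eltV) x.

Fact graph_mulVf x : x != 0 -> graph_inv x * x = 1.
Proof.
move=> x_neq0; rewrite /graph_inv (negPf x_neq0).
exact: (projT2 (choice graph_eltV)).
Qed.

Fact graph_invr0 : graph_inv 0 = 0.
Proof. by rewrite /graph_inv eqxx. Qed.
HB.instance Definition _ :=
  GRing.ComNzRing_isField.Build graph_elt graph_mulVf graph_invr0.

Let graph_cst (c : L) : graph_elt := GraphElt (asboolT (graph_base gG c)).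

Fact graph_cst_zmod : zmod_morphism graph_cst.
Proof. by move=> c d; apply: val_inj; rewrite /= rmorphB. Qed.
Fact graph_cst_monoid : monoid_morphism graph_cst.
Proof. by split=> [|c d]; apply: val_inj; rewrite /= ?rmorph1 ?rmorphM. Qed.
HB.instance Definition _ :=
  GRing.isZmodMorphism.Build L graph_elt graph_cst graph_cst_zmod.
HB.instance Definition _ :=
  GRing.isMonoidMorphism.Build L graph_elt graph_cst graph_cst_monoid.

(** The graph itself serves as the field [E], with its two projections as [iota] and [tau]; this is
    the setting of [congruent_conjugate]. *)
Lemma graph_field : exists (E : fieldType) (iE : {rmorphism L -> E})
    (iota tau : {rmorphism E -> K}),
  [/\ forall c, iota (iE c) = iL c, forall c, tau (iE c) = iL c &
      forall p, G p <-> exists x, p = (iota x, tau x)].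
Proof.
exists graph_elt, graph_cst, (fst \o val), (snd \o val); split=> // p.
split=> [Gp|[[q q_mem] ->]].
  by exists (GraphElt (asboolT Gp)); case: p Gp.
by have /asboolP := q_mem; case: q q_mem.
Qed.
End GraphField.

(** With [f] the minimal polynomial of [a] over [E] and [b] a congruent root of its image under
    [tau], the pairs (q(a), q(b)) form the new graph. It is functional because q(a) = 0 forces [f]
    to divide q, whence q(b) = 0. *)
Lemma graph_extend G (a : K) : congruence_graph G ->
  exists G', [/\ congruence_graph G', G `<=` G' & exists b, G' (a, b)].
Proof.
move=> gG; have [E [iE [iota [tau [iotaE tauE GE]]]]] := graph_field gG.
have [p0 [p0_monic _ p0a p0_sep]] := K_sep.1 a.
have p0_neq0 : map_poly iE p0 != 0 by rewrite map_poly_eq0 monic_neq0.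
have iotap q : map_poly iota (map_poly iE q) = map_poly iL q.
  by rewrite -map_poly_comp; apply: eq_map_poly.
have [|f [f_monic fa f_min]] := minimal_annihilator (iota := iota) (a := a) p0_neq0.
  by rewrite iotap.
have f_sep : separable_poly f.
  apply: (@dvdp_separable _ (map_poly iE p0)); last by rewrite separable_map.
  by apply: f_min; rewrite iotap.
have splits (sigma : {rmorphism E -> K}) :
    exists rs, map_poly sigma f = \prod_(x <- rs) ('X - x%:P).
  by apply: separable_splits K_sep.2 _ _; rewrite ?map_monic ?separable_map.
have [[rs f_iota] [rs' f_tau]] := (splits iota, splits tau).
have a_rs : a \in rs by rewrite -root_prod_XsubC -f_iota.
have iotaA c : iota ((iE \o iA) c) = (iL \o iA) c by rewrite /= iotaE.
have tauA c : tau ((iE \o iA) c) = (iL \o iA) c by rewrite /= tauE.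
have iota_tau x u w : v u = iota x -> v w = tau x -> red u = red w.
  by apply: (graph_congr gG (p := (iota x, tau x))); apply/GE; exists x.
have [b rs'b congr_b] := congruent_conjugate v_inj v_int v_surj iotaA tauA iota_tau
  f_monic f_iota f_tau a_rs f_min.
have fb : root (map_poly tau f) b by rewrite f_tau root_prod_XsubC.
exists [set p | exists q, p = ((map_poly iota q).[a], (map_poly tau q).[b])].
split; first split.
- by move=> _ _ [q ->] [r ->]; exists (q - r); rewrite !rmorphB !hornerD !hornerN.
- by move=> _ _ [q ->] [r ->]; exists (q * r); rewrite !rmorphM !hornerM.
- by move=> c; exists (iE c)%:P; rewrite !map_polyC !hornerC /= iotaE tauE.
- move=> _ [q ->] /= /rootP/f_min/dvdpP[g ->].
  by rewrite rmorphM hornerM (rootP fb) mulr0.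
- by move=> _ u w [q ->] /= uE wE; apply: congr_b uE wE.
- by move=> _ /GE[x ->]; exists x%:P; rewrite !map_polyC !hornerC.
- by exists b, 'X; rewrite !map_polyX !hornerX.
Qed.

Lemma graph_total G0 : congruence_graph G0 ->
  exists G, [/\ congruence_graph G, G0 `<=` G & forall a, exists b, G (a, b)].
Proof.
(* The union with [G0] makes the property hold for the empty set, which is the union of the empty
   chain. *)
move=> gG0; pose P (G : set (K * K)) := congruence_graph (G0 `|` G).
have [F FP F_total|G [gG G_max]] := @Zorn_bigcup _ P.
  have [[X0 FX0]|nF] := pselect (exists X, F X); last first.
    suff -> : \bigcup_(X in F) X = set0 by rewrite /P setU0.
    by rewrite -subset0 => p [X FX _]; apply: nF; exists X.
  set U := \bigcup_(X in F) X.
  have pair_mem p q : (G0 `|` U) p -> (G0 `|` U) q ->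
      exists X, [/\ F X, (G0 `|` X) p & (G0 `|` X) q].
    case=> [G0p|[X FX Xp]] [G0q|[Y FY Yq]].
    - by exists X0; split=> //; left.
    - by exists Y; split=> //; [left|right].
    - by exists X; split=> //; [right|left].
    have [XY|YX] := F_total X Y FX FY.
      by exists Y; split=> //; right=> //; apply: XY.
    by exists X; split=> //; right=> //; apply: YX.
  have subU X : F X -> G0 `|` X `<=` G0 `|` U.
    by move=> FX p [G0p|Xp]; [left|right; exists X].
  split.
  - move=> p q Up Uq; have [X [FX Xp Xq]] := pair_mem p q Up Uq.
    by apply: (subU X FX); apply: graphB (FP X FX) _ _ Xp Xq.
  - move=> p q Up Uq; have [X [FX Xp Xq]] := pair_mem p q Up Uq.
    by apply: (subU X FX); apply: graphM (FP X FX) _ _ Xp Xq.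
  - by move=> c; left; apply: graph_base.
  - move=> p Up; have [X [FX Xp _]] := pair_mem p p Up Up.
    exact: graph_functional (FP X FX) _ Xp.
  - move=> p u w Up; have [X [FX Xp _]] := pair_mem p p Up Up.
    exact: graph_congr (FP X FX) _ _ _ Xp.
exists (G0 `|` G); split=> // a.
have [G' [gG' subG' [b G'ab]]] := graph_extend a gG.
apply: contrapT => nGa; apply: (G_max G').
  split; first by move=> p Gp; apply: subG'; right.
  by apply: contra_not nGa => subG; exists b; right; apply: subG.
rewrite /P (_ : G0 `|` G' = G') //; apply/seteqP; split=> [p [G0p|]|p] //; last by right.
by apply: subG'; left.
Qed.

Lemma inertia_rigid (m : set K) (F : fieldType) (iF : {rmorphism L -> F})
    (j sigma : {rmorphism F -> K}) :
    (forall u, red u = 0 -> m (v u)) ->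
    (forall c, j (iF c) = iL c) -> (forall c, sigma (iF c) = iL c) ->
    (forall x, absolute_inertia_field iA iL m (j x)) ->
    (forall x u w, v u = j x -> v w = sigma x -> red u = red w) ->
  sigma =1 j.
Proof.
move=> red_m jL sigmaL jF j_sigma.
pose G0 : set (K * K) := [set p | exists x, p = (j x, sigma x)].
have gG0 : congruence_graph G0.
  split.
  - by move=> _ _ [x ->] [y ->]; exists (x - y); rewrite !rmorphB.
  - by move=> _ _ [x ->] [y ->]; exists (x * y); rewrite !rmorphM.
  - by move=> c; exists (iF c); rewrite jL sigmaL.
  - by move=> _ [x ->] /= /eqP; rewrite fmorph_eq0 => /eqP->; rewrite rmorph0.
  - by move=> _ u w [x ->]; apply: j_sigma.
have [G [gG subG /choice[s Gs]]] := graph_total gG0.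
(* Two pairs with the same first component differ by a pair starting with 0, so [G] determines [s];
   the morphism laws then come from the closure properties of [G]. *)
have sE x y : G (x, y) -> s x = y.
  move=> Gxy; have := graph_functional gG (graphB gG (Gs x) Gxy).
  by rewrite /= subrr => /(_ erefl)/eqP; rewrite subr_eq0 => /eqP.
have s_zmod : zmod_morphism s by move=> x y; apply: sE; exact: graphB (Gs x) (Gs y).
have s_monoid : monoid_morphism s.
  split=> [|x y]; last by apply: sE; exact: graphM (Gs x) (Gs y).
  by apply: sE; have := graph_base gG 1; rewrite rmorph1.
pose sR : {rmorphism K -> K} := HB.pack s
  (GRing.isZmodMorphism.Build K K s s_zmod) (GRing.isMonoidMorphism.Build K K s s_monoid).
have sL c : sR (iL c) = iL c by apply: sE; apply: graph_base.
have s_root (p : {poly L}) x : root (map_poly iL p) x -> root (map_poly iL p) (sR x).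
  move=> px; have := rmorph_root sR px.
  by rewrite -map_poly_comp (eq_map_poly (g := iL)).
(* The injective map [sR] sends the finite set of roots of a polynomial over [L] into itself, hence
   onto itself. *)
have s_surj y : exists x, sR x = y.
  have [p [p_monic _ py p_sep]] := K_sep.1 y.
  have p_sepK : separable_poly (map_poly iL p) by rewrite separable_map.
  have [|rs pE] := separable_splits K_sep.2 _ p_sepK; first by rewrite map_monic.
  have rs_uniq : uniq rs by rewrite -separable_prod_XsubC -pE.
  have rsP x : (x \in rs) = root (map_poly iL p) x by rewrite pE root_prod_XsubC.
  have : y \in map sR rs.
    have sub_rs : {subset map sR rs <= rs}.
      by move=> z /mapP[x rs_x ->]; rewrite rsP; apply: s_root; rewrite -rsP.
    have map_uniq : uniq (map sR rs) by rewrite map_inj_uniq //; apply: fmorph_inj.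
    have [|_ ->] := uniq_min_size map_uniq sub_rs; first by rewrite size_map.
    by rewrite rsP.
  by case/mapP=> x _ ->; exists x.
have [g gK] := choice s_surj.
have sI : absolute_inertia_group iA iL m sR.
  split.
    split=> //; exists g => // x; apply: (fmorph_inj sR).
    by rewrite gK.
  move=> x /[dup] [[p p_monic px]] /v_surj[u uE].
  have [w wE] : exists w, v w = sR x.
    apply: v_surj; exists p => //; move: px; rewrite map_poly_comp; exact: s_root.
  rewrite -uE uE -{1}uE -wE -rmorphB; apply: red_m.
  rewrite rmorphB; apply/eqP; rewrite subr_eq0; apply/eqP.
  exact: (graph_congr gG (Gs x)).
move=> x; have /= <- := jF x sR sI.
by apply/esym/sE/subG; exists x.
Qed.
End Graphs.

(** * Elements separating one homomorphism from finitely many others *)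

(** A duplicate-free list of maximal length cannot miss an element satisfying [P]. *)
Lemma bounded_pred_seq (T : eqType) (P : T -> Prop) (B : nat) :
    (forall s, uniq s -> (forall x, x \in s -> P x) -> (size s <= B)%N) ->
  exists2 s, uniq s & forall x, x \in s <-> P x.
Proof.
move=> P_bound.
pose Q n := `[< exists s, [/\ uniq s, size s = n & forall x, x \in s -> P x] >].
have exQ : exists n, Q n by exists 0%N; apply/asboolP; exists [::].
have Q_le n : Q n -> (n <= B)%N.
  by move=> /asboolP[s [s_uniq <- sP]]; apply: P_bound.
have [n /asboolP[s [s_uniq sz_s sP]] n_max] := ex_maxnP exQ Q_le.
exists s => // x; split=> [/sP //|Px]; apply: contraT => s'x.
have /n_max : Q n.+1.
  apply/asboolP; exists (x :: s); split; rewrite /= ?s'x ?sz_s //.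
  by move=> y; rewrite inE => /predU1P[->|/sP].
by rewrite ltnn.
Qed.

Lemma common_root_of_unity_order (T : finType) (kappa : fieldType) (z : T -> kappa) :
    (forall t, z t = 0 \/ exists2 M, (0 < M)%N & z t ^+ M = 1) ->
  exists2 M, (0 < M)%N & forall t, z t = 0 \/ z t ^+ M = 1.
Proof.
move=> z_unity.
have /choice[M MP] t : exists M, (0 < M)%N /\ (z t = 0 \/ z t ^+ M = 1).
  have [z0|[M M_gt0 zM]] := z_unity t; first by exists 1%N; split=> //; left.
  by exists M; split=> //; right.
exists (\prod_t M t)%N; first by apply: prodn_gt0 => t; case: (MP t).
move=> t; have [_ [zt0|ztM]] := MP t; [by left|right].
by rewrite (bigD1 t) //= exprM ztM expr1n.
Qed.

Section SeparatingHom.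
Variables (A C : comNzRingType) (kappa : fieldType) (g : {rmorphism A -> C}).
Variables (phi0 : {rmorphism C -> kappa}).
Hypothesis C_int : forall c, integralOver g c.

(** Dividing by an integral equation of degree d writes each power of [psi c] as a combination of
    its first d powers with coefficients in the finite list [s]. There are finitely many coefficient
    vectors, so two powers coincide. *)
Lemma integral_root_of_unity (s : seq kappa) (psi : {rmorphism C -> kappa}) (c : C) :
    (forall a, psi (g a) \in s) ->
  psi c = 0 \/ exists2 M, (0 < M)%N & psi c ^+ M = 1.
Proof.
move=> sP; have [p p_monic pc] := C_int c; pose d := (size p).-1.
pose r k : {poly A} := Pdiv.CommonRing.rmodp 'X^k p.
have p_gt0 : (0 < size p)%N by rewrite size_poly_gt0 monic_neq0.
have powE k : psi c ^+ k = \sum_(i < d) psi (g (r k)`_i) * psi c ^+ i.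
  have := Pdiv.RingMonic.rdivp_eq p_monic 'X^k => /(congr1 (map_poly (psi \o g))).
  move=> /(congr1 (horner^~ (psi c))).
  rewrite rmorphD rmorphM /= map_polyXn hornerXn hornerD hornerM.
  have -> : (map_poly (psi \o g) p).[psi c] = 0.
    by rewrite map_poly_comp horner_map (rootP pc) rmorph0.
  rewrite mulr0 add0r => ->; rewrite (@horner_coef_wide _ d).
    by apply: eq_bigr => i _; rewrite coef_map.
  rewrite (leq_trans (size_poly _ _)) // -ltnS prednK //.
  by rewrite Pdiv.CommonRing.ltn_rmodpN0 ?monic_neq0.
pose h (k : 'I_#|{ffun 'I_d -> seq_sub s}|.+1) : {ffun 'I_d -> seq_sub s} :=
  [ffun i : 'I_d => SeqSub (sP (r k)`_i)].
have /injectivePn[k [l neq_kl hkl]] : ~~ injectiveb h.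
  by apply/injectiveP => /leq_card; rewrite card_ord ltnn.
have {hkl} ckl : psi c ^+ k = psi c ^+ l.
  rewrite !powE; apply: eq_bigr => i _; congr (_ * _).
  by have /ffunP/(_ i) := hkl; rewrite !ffunE => /(congr1 val).
have [->|c_neq0] := eqVneq (psi c) 0; [by left|right].
wlog lt_kl : k l neq_kl ckl / (k < l)%N => [gen|].
  have /orP[] : (k < l)%N || (l < k)%N by rewrite -neq_ltn.
    exact: gen.
  by apply: gen; rewrite ?ckl // eq_sym.
exists (l - k)%N; first by rewrite subn_gt0.
by apply: (mulIf (expf_neq0 k c_neq0)); rewrite -exprD subnK 1?ltnW // ckl mul1r.
Qed.

(** The element is the value at some [t] in [A] of a polynomial whose coefficients include all
    [x i]. All the homomorphisms send [t] to the same point of [kappa], which only has to avoid the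
    roots of one nonzero polynomial. *)
Lemma separating_hom_element_infinite (n : nat) (phi : 'I_n -> {rmorphism C -> kappa}) (x : 'I_n -> C) :
    (forall B, exists s : seq A, (B < size s)%N /\ uniq (map (phi0 \o g) s)) ->
    (forall i a, phi i (g a) = phi0 (g a)) ->
    (forall i, phi i (x i) != phi0 (x i)) ->
  exists2 eta, phi0 eta != 0 & forall i, phi i eta != phi0 eta.
Proof.
move=> A_inf phiA phi_x.
(* The leading term keeps the image under [phi0] nonzero. The default 0 is never reached, as k <
   n. *)
pose X : {poly C} := 'X^n + \poly_(k < n) oapp x 0 (insub k).
have Xn : X`_n = 1 by rewrite coefD coefXn coef_poly eqxx ltnn addr0.
have X_neq0 : map_poly phi0 X != 0.
  apply/eqP => /polyP/(_ n)/eqP.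
  by rewrite coef_map Xn coef0 /= rmorph1 oner_eq0.
have X_neq i : map_poly (phi i) X - map_poly phi0 X != 0.
  rewrite subr_eq0; apply: contra_neq (phi_x i) => /polyP/(_ (val i)).
  by rewrite !coef_map coefD coefXn coef_poly ltn_ord valK (ltn_eqF (ltn_ord i)) add0r.
pose P := map_poly phi0 X * \prod_i (map_poly (phi i) X - map_poly phi0 X).
have P_neq0 : P != 0 by rewrite mulf_neq0 //; apply/prodf_neq0 => i _.
have [s [sz_s s_uniq]] := A_inf (size P).
have /allPn[_ /mapP[t _ ->]] : ~~ all (root P) (map (phi0 \o g) s).
  apply: contraTN sz_s => /(max_poly_roots P_neq0)/(_ s_uniq).
  by rewrite size_map -leqNgt => /ltnW.
rewrite /root hornerM mulf_eq0 negb_or horner_prod => /andP[Xt /prodf_neq0 XtP].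
exists X.[g t]; first by rewrite -horner_map.
move=> i; have := XtP i isT.
by rewrite hornerD hornerN subr_eq0 /= horner_map -(phiA i) horner_map.
Qed.

(** The [phi0 (x i)] are roots of unity in a finite cyclic group with generator [phi0 theta]. The
    element [theta] settles the [i] whose [phi i] moves it; for the others it is multiplied by some
    [e] that [phi0] sends to 1 and these [phi i] send to 0. *)
Lemma separating_hom_element_finite (n : nat) (phi : 'I_n -> {rmorphism C -> kappa}) (x : 'I_n -> C)
    (s : seq kappa) :
    (forall a, phi0 (g a) \in s) ->
    (forall i a, phi i (g a) = phi0 (g a)) ->
    (forall i, phi0 (x i) != 0) -> (forall i, phi i (x i) != phi0 (x i)) ->
  exists2 eta, phi0 eta != 0 & forall i, phi i eta != phi0 eta.
Proof.
move=> sP phiA x_neq0 phi_x.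
have [M M_gt0 xM] := common_root_of_unity_order
  (fun i => integral_root_of_unity (x i) sP).
have {}xM i : phi0 (x i) ^+ M = 1.
  by case: (xM i) => // xi0; have := x_neq0 i; rewrite xi0 eqxx.
have [rs rs_uniq rsP] : exists2 rs, uniq rs &
    forall z, z \in rs <-> z ^+ M = 1 /\ exists c, z = phi0 c.
  apply: (@bounded_pred_seq _ _ M) => rs rs_uniq rsP.
  apply: max_unity_roots => //; apply/allP => z /rsP[zM _].
  by apply/unity_rootP.
have rs1 : 1 \in rs by apply/rsP; rewrite expr1n; split=> //; exists 1; rewrite rmorph1.
have rsM y z : y \in rs -> z \in rs -> y * z \in rs.
  move=> /rsP[yM [c yE]] /rsP[zM [d zE]]; apply/rsP.
  by rewrite exprMn yM zM mulr1; split=> //; exists (c * d); rewrite rmorphM yE zE.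
have rs_neq0 y : y \in rs -> y != 0.
  by move=> /rsP[yM _]; apply: contra_eq_neq yM => ->; rewrite expr0n gtn_eqF // eq_sym oner_eq0.
have sz_rs : (0 < size rs)%N by case: (rs) rs1.
(* Multiplication by an element of the finite group rs permutes it. *)
have rs_unity : all (size rs).-unity_root rs.
  apply/allP => y rs_y; apply/unity_rootP.
  have y_inj : injective ( *%R y) by apply: mulfI; apply: rs_neq0.
  have yrs_uniq : uniq (map ( *%R y) rs) by rewrite map_inj_uniq.
  have yrs_sub : {subset map ( *%R y) rs <= rs}.
    by move=> _ /mapP[z rs_z ->]; apply: rsM.
  have [|_ yrs_eq] := uniq_min_size yrs_uniq yrs_sub; first by rewrite size_map.
  have : \prod_(z <- map ( *%R y) rs) z = \prod_(z <- rs) z.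
    by apply/perm_big/uniq_perm.
  rewrite big_map big_split /= big_const_seq count_predT iter_mulr_1.
  rewrite -[RHS]mul1r; apply: mulIf.
  by rewrite prodf_seq_neq0; apply/allP => z /rs_neq0.
have /hasP[_ /rsP[_ [theta ->]] theta_prim] :=
  has_prim_root sz_rs rs_unity rs_uniq (leqnn _).
have theta_neq0 : phi0 theta != 0.
  have := prim_expr_order theta_prim.
  by apply: contra_eq_neq => ->; rewrite expr0n gtn_eqF // eq_sym oner_eq0.
(* theta generates phi0 of all the x i.  Where phi i does not move theta, y i lies in
   the kernel of phi0 but not of phi i, so 1 - y i ^+ N is sent to 1 by phi0 and
   to 0 by phi i. *)
have /choice[y yP] i : exists y, phi0 y = 0 /\ (phi i theta = phi0 theta -> phi i y != 0).
  have : phi0 (x i) ^+ size rs = 1.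
    apply/unity_rootP/(allP rs_unity)/rsP; split=> //; by exists (x i).
  case/(prim_rootP theta_prim) => e xE.
  exists (x i - theta ^+ e); rewrite !rmorphB !rmorphXn -xE subrr; split=> // ->.
  by rewrite -xE subr_eq0.
have phi_s k a : phi k (g a) \in s by rewrite phiA.
have [N N_gt0 yN] := common_root_of_unity_order
  (fun ik : 'I_n * 'I_n => integral_root_of_unity (y ik.2) (phi_s ik.1)).
(* As [N] serves all pairs (k, i), every [phi k] sends each factor to 0 or 1. So where [phi k] moves
   [theta], it sends [theta * e] to 0 or to [phi k theta], both different from [phi0 theta]. *)
pose e := \prod_i (1 - y i ^+ N).
have e0 : phi0 e = 1.
  rewrite rmorph_prod big1 // => i _.
  by rewrite rmorphB rmorphXn rmorph1 (yP i).1 expr0n gtn_eqF //= subr0.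
have e01 k : phi k e = 0 \/ phi k e = 1.
  rewrite rmorph_prod; apply: (big_ind (fun z => z = 0 \/ z = 1)).
  - by right.
  - by move=> _ _ [->|->] [->|->]; rewrite ?(mul0r, mulr0, mulr1); auto.
  move=> i _; rewrite rmorphB rmorphXn rmorph1.
  case: (yN (k, i)) => /= ->; last by left; rewrite subrr.
  by right; rewrite expr0n gtn_eqF //= subr0.
exists (theta * e); first by rewrite rmorphM e0 mulr1.
move=> k; rewrite !rmorphM e0 mulr1.
have [theta_k|theta_k] := eqVneq (phi k theta) (phi0 theta); last first.
  by case: (e01 k) => ->; rewrite ?mulr1 // mulr0 eq_sym.
have [yk0|ykN] := yN (k, k); first by have := (yP k).2 theta_k; rewrite yk0 eqxx.
have -> : phi k e = 0.
  by rewrite rmorph_prod (bigD1 k) //= rmorphB rmorphXn rmorph1 ykN subrr mul0r.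
by rewrite mulr0 eq_sym.
Qed.

(** The argument depends on whether the image of [A] in [kappa] is infinite. In either case the
    elements [x i] are first moved off the kernel of [phi0], by adding 1 if necessary. *)
Lemma separating_hom_element (n : nat) (phi : 'I_n -> {rmorphism C -> kappa}) :
    (forall i a, phi i (g a) = phi0 (g a)) -> (forall i, exists x, phi i x <> phi0 x) ->
  exists2 eta, phi0 eta != 0 & forall i, phi i eta != phi0 eta.
Proof.
move=> phiA phi_neq.
have /choice[x xP] i : exists x, phi0 x != 0 /\ phi i x != phi0 x.
  have [x /eqP phi_x] := phi_neq i; have [x0|] := eqVneq (phi0 x) 0; last by exists x.
  exists (x + 1); rewrite !rmorphD !rmorph1 x0 add0r oner_neq0; split=> //.
  by apply: contra_neq phi_x => /(canRL (addrK 1)) ->; rewrite subrr x0.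
have [A_inf|A_fin] := pselect (forall B, exists s : seq A,
    (B < size s)%N /\ uniq (map (phi0 \o g) s)).
  by apply: (separating_hom_element_infinite (x := x)) => // i; case: (xP i).
have [s _ sP] : exists2 s, uniq s & forall z, z \in s <-> exists a, z = phi0 (g a).
  have [B BP] : exists B, forall s : seq A, uniq (map (phi0 \o g) s) -> (size s <= B)%N.
    apply: contrapT => nB; apply: A_fin => B; apply: contrapT => nBs; apply: nB.
    exists B => s s_uniq; rewrite leqNgt; apply/negP => lt_B; apply: nBs.
    by exists s.
  apply: (@bounded_pred_seq _ _ B) => s s_uniq sP.
  have [t sE] : exists t, s = map (phi0 \o g) t.
    elim: s {s_uniq} sP => [|z s IHs] sP; first by exists [::].
    have [|t ->] := IHs; first by move=> y s_y; apply: sP; rewrite inE s_y orbT.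
    by have [a ->] := sP z (mem_head _ _); exists (a :: t).
  by rewrite sE size_map; apply: BP; rewrite -sE.
apply: (separating_hom_element_finite (x := x) (s := s)) => //.
- by move=> a; apply/sP; exists a.
- by move=> i; case: (xP i).
- by move=> i; case: (xP i).
Qed.
End SeparatingHom.

(** * Residue fields and generators *)

Section ResidueField.
Variables (I : comNzRingType) (P : set I).
Hypotheses (P0 : P 0) (P1 : ~ P 1).
Hypothesis PD : forall a u w, P u -> P w -> P (a * u + w).
Hypothesis P_max : forall u, ~ P u -> exists w, P (w * u - 1).

Let ideal_mem : {pred I} := [pred u | `[< P u >]].

Fact ideal_mem_closed : idealr_closed ideal_mem.
Proof.
split; first exact/asboolP.
  by apply/negP => /asboolP.
by move=> a u w /asboolP Pu /asboolP Pw; apply/asboolP/PD.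
Qed.
HB.instance Definition _ := isIdealr.Build I ideal_mem ideal_mem_closed.

Local Notation residue_ring := {ideal_quot ideal_mem}.
Let proj (u : I) : residue_ring := (\pi_residue_ring u)%qT.

Lemma proj_eq0 u : proj u = 0 <-> P u.
Proof.
have -> : 0 = proj 0 by rewrite /proj rmorph0.
split=> [/eqP|/asboolP Pu].
  by rewrite /proj -Quotient.idealrBE subr0 => /asboolP.
by apply/eqP; rewrite /proj -Quotient.idealrBE subr0.
Qed.

Lemma residue_ringV (x : residue_ring) : exists y, x != 0 -> y * x = 1.
Proof.
elim/quotW: x => u.
have [Pu|/P_max[w Pwu]] := pselect (P u).
  by exists 0 => /eqP[]; apply/proj_eq0.
exists (proj w) => _; apply/eqP; rewrite -subr_eq0; apply/eqP.
by have /proj_eq0 := Pwu; rewrite /proj rmorphB rmorphM rmorph1.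
Qed.

Let residue_inv x : residue_ring := if x == 0 then 0 else projT1 (choice residue_ringV) x.

Fact residue_mulVf x : x != 0 -> residue_inv x * x = 1.
Proof.
move=> x_neq0; rewrite /residue_inv (negPf x_neq0).
exact: (projT2 (choice residue_ringV)).
Qed.

Fact residue_invr0 : residue_inv 0 = 0.
Proof. by rewrite /residue_inv eqxx. Qed.

Lemma residue_field : exists (kappa : fieldType) (red : {rmorphism I -> kappa}),
  forall u, red u = 0 <-> P u.
Proof.
pose kappa : fieldType := HB.pack residue_ring
  (GRing.ComNzRing_isField.Build residue_ring residue_mulVf residue_invr0).
pose red : {rmorphism I -> kappa} := HB.pack proj
  (GRing.isZmodMorphism.Build I kappa proj (rmorphB _))
  (GRing.isMonoidMorphism.Build I kappa proj (rmorph1 _, rmorphM _)).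
by exists kappa, red; apply: proj_eq0.
Qed.
End ResidueField.

(** * Transport of integral elements *)

Section IntegralMap.
Variables (A : comNzRingType) (K K' : fieldType).
Variables (f : {rmorphism A -> K}) (f' : {rmorphism A -> K'}) (h : {rmorphism K -> K'}).
Hypothesis hf : forall a, h (f a) = f' a.

Lemma integral_map_proof (x : integral_ring f) : h (integral_val x) \in integral_elt f'.
Proof.
have /integral_eltP[p p_monic px] := integral_valP x.
apply/integral_eltP; exists p => //.
have /(rmorph_root h) := px.
by rewrite -map_poly_comp (eq_map_poly (g := f')).
Qed.

(** Followed by reduction, this yields the homomorphism to the residue field attached to an
    embedding of [F]. *)
Definition integral_map (x : integral_ring f) : integral_ring f' :=
  IntegralElt (integral_map_proof x).

Fact integral_map_zmod : zmod_morphism integral_map.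
Proof. by move=> x y; apply: val_inj; rewrite /= rmorphB. Qed.
Fact integral_map_monoid : monoid_morphism integral_map.
Proof. by split=> [|x y]; apply: val_inj; rewrite /= ?rmorph1 ?rmorphM. Qed.
HB.instance Definition _ :=
  GRing.isZmodMorphism.Build _ _ integral_map integral_map_zmod.
HB.instance Definition _ :=
  GRing.isMonoidMorphism.Build _ _ integral_map integral_map_monoid.
End IntegralMap.

Section IntegralCst.
Variables (A : comNzRingType) (K : fieldType) (f : {rmorphism A -> K}).

Lemma integral_cst_proof (a : A) : f a \in integral_elt f.
Proof. exact/integral_eltP/integral_id. Qed.

Definition integral_cst (a : A) : integral_ring f := IntegralElt (integral_cst_proof a).

Fact integral_cst_zmod : zmod_morphism integral_cst.
Proof. by move=> x y; apply: val_inj; rewrite /= rmorphB. Qed.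
Fact integral_cst_monoid : monoid_morphism integral_cst.
Proof. by split=> [|x y]; apply: val_inj; rewrite /= ?rmorph1 ?rmorphM. Qed.
HB.instance Definition _ :=
  GRing.isZmodMorphism.Build _ _ integral_cst integral_cst_zmod.
HB.instance Definition _ :=
  GRing.isMonoidMorphism.Build _ _ integral_cst integral_cst_monoid.

Lemma integral_ring_integral (c : integral_ring f) : integralOver integral_cst c.
Proof.
have /integral_eltP[p p_monic px] := integral_valP c; exists p => //.
apply/rootP/val_inj; rewrite rmorph0 -horner_map -map_poly_comp; exact/rootP.
Qed.

Lemma integral_coef_prod_XsubC (rs : seq K) i :
  (forall x, x \in rs -> integralOver f x) ->
  integralOver f (\prod_(x <- rs) ('X - x%:P))`_i.
Proof.
elim: rs i => [|x rs IHrs] i rs_int.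
  by rewrite big_nil coef1; apply: integral_nat.
have rs_int' k : integralOver f (\prod_(x <- rs) ('X - x%:P))`_k.
  by apply: IHrs => y rs_y; apply: rs_int; rewrite inE rs_y orbT.
rewrite big_cons mulrBl coefB coefXM coefCM.
apply: integral_sub; first by case: ifP => // _; apply: integral0.
by apply: integral_mul => //; apply/rs_int/mem_head.
Qed.
End IntegralCst.

(** * Homomorphisms on a simple extension *)

Section AdjoinHom.
Variables (L : fieldType) (F : fieldExtType L) (K : fieldType) (j : {rmorphism F -> K}).
Variables (U : {subfield F}) (x : F).
Hypothesis Ux : <<U; x>>%VS = {:F}%VS.

Lemma eq_adjoin_hom (s s' : {rmorphism F -> K}) :
  {in U, s =1 s'} -> s x = s' x -> s =1 s'.
Proof.
move=> ss' ss'x y; have /Fadjoin_poly_eq <- : y \in <<U; x>>%VS by rewrite Ux memvf.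
rewrite -!horner_map ss'x; congr (_.[_]); apply/polyP => i; rewrite !coef_map.
exact/ss'/polyOverP/Fadjoin_polyOver.
Qed.

(** An element p(x) is sent to the value at [r] of the image of p. Reducing p modulo the minimal
    polynomial does not change that value, so sums and products are respected. *)
Lemma adjoin_hom (r : K) : root (map_poly j (minPoly U x)) r ->
  exists s : {rmorphism F -> K}, {in U, s =1 j} /\ s x = r.
Proof.
move=> mr; pose P := Fadjoin_poly U x.
have PK y : (P y).[x] = y by rewrite Fadjoin_poly_eq // Ux memvf.
have PO y : P y \is a polyOver U by apply: Fadjoin_polyOver.
pose s y := (map_poly j (P y)).[r].
have s_horner p : p \is a polyOver U -> s p.[x] = (map_poly j p).[r].
  move=> pU; rewrite /s /P Fadjoin_poly_mod // [in RHS](divp_eq p (minPoly U x)).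
  by rewrite rmorphD rmorphM hornerD hornerM (rootP mr) mulr0 add0r.
have s_zmod : zmod_morphism s.
  move=> y z; rewrite -{1}[y]PK -{1}[z]PK -hornerN -hornerD s_horner ?rpredB //.
  by rewrite rmorphB hornerD hornerN.
have sU : {in U, s =1 j}.
  by move=> y Uy; rewrite -[y in LHS](hornerC y x) s_horner ?polyOverC // map_polyC hornerC.
have s_monoid : monoid_morphism s.
  split=> [|y z]; first by rewrite sU ?rmorph1 ?rpred1.
  by rewrite -{1}[y]PK -{1}[z]PK -hornerM s_horner ?rpredM // rmorphM hornerM.
pose sR : {rmorphism F -> K} := HB.pack s
  (GRing.isZmodMorphism.Build F K s s_zmod) (GRing.isMonoidMorphism.Build F K s s_monoid).
exists sR; split=> //=.
by rewrite -[x in LHS](hornerX x) s_horner ?polyOverX // map_polyX hornerX.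
Qed.
End AdjoinHom.

Lemma residue_of_maximal (A : idomainType) (K : fieldType) (f : {rmorphism A -> K})
    (m : set K) : maximal_ideal_of (integral_closure f) m ->
  exists (kappa : fieldType) (red : {rmorphism integral_ring f -> kappa}),
    forall u, red u = 0 <-> m (val u).
Proof.
move=> [[subm m0 mD mM] m_neq m_max].
have val_int (u : integral_ring f) : integral_closure f (val u).
  exact/integral_eltP/integral_valP.
apply: (residue_field (P := fun u => m (val u))) => //.
- move=> m1; apply: m_neq; apply/seteqP; split=> // x Sx.
  by rewrite -[x]mulr1; apply: mM.
- by move=> a u w mu mw; rewrite rmorphD rmorphM; exact/mD/mw/mM/mu/val_int.
move=> u nmu.
(* The ideal generated by [m] and [u]: were it proper, maximality would put [u] in [m]. So it
   contains 1, which inverts [u] modulo [m]. *)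
pose J := [set x | exists a b, [/\ m a, integral_closure f b & x = a + b * val u]].
have JI : ideal_of (integral_closure f) J.
  split.
  - move=> _ [a [b [ma Sb ->]]]; apply: integral_add; first exact: subm.
    by apply: integral_mul => //; apply: val_int.
  - by exists 0, 0; split=> //; [apply: integral0|rewrite mul0r addr0].
  - move=> _ _ [a [b [ma Sb ->]]] [c [d [mc Sd ->]]]; exists (a + c), (b + d).
    by split; [apply: mD|apply: integral_add|rewrite mulrDl addrACA].
  - move=> x _ Sx [a [b [ma Sb ->]]]; exists (x * a), (x * b).
    by split; [apply: mM|apply: integral_mul|rewrite mulrDr mulrA].
have [JS|JS] := pselect (J = integral_closure f); last first.
  case: nmu; rewrite -(m_max J JI JS) => [|a ma].
    by exists 0, 1; split=> //; [apply: integral1|rewrite mul1r add0r].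
  by exists a, 0; split=> //; [apply: integral0|rewrite mul0r addr0].
have : J 1 by rewrite JS; apply: integral1.
case=> a [b [ma Sb E1]].
have /integral_eltP b_mem := Sb.
exists (IntegralElt b_mem).
rewrite rmorphB rmorphM rmorph1 /= E1 opprD addrCA subrr addr0 -mulN1r.
apply: mM => //; rewrite -(rmorphN1 f); exact: integral_id.
Qed.

(** * The generator of the inertial extension *)

Section Main.
Variables (A : idomainType) (L : fieldType) (iA : {rmorphism A -> L}).
Variables (Lsep : fieldType) (iL : {rmorphism L -> Lsep}) (m : set Lsep).
Variables (F : fieldExtType L) (j : {rmorphism F -> Lsep}).
Hypothesis hA_closed : integrally_closed iA.
Hypothesis hLsep : separable_closure iL.
Hypothesis hj : forall a : L, j (a%:A) = iL a.
Hypothesis hF : forall x : F, absolute_inertia_field iA iL m (j x).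

Variables (kappa : fieldType) (red : {rmorphism integral_ring (iL \o iA) -> kappa}).
Hypothesis red_m : forall u, red u = 0 <-> m (val u).

Local Notation iK := (iL \o iA).
Local Notation iF := (in_alg F \o iA).
Local Notation B := (localization_at_trace iK j m).

Lemma trace_integralE x : integralOver iF x <-> trace_integral_closure iK j x.
Proof.
have iFK : j \o iF =1 iK by move=> a /=; rewrite hj.
split=> -[p p_monic px]; exists p => //.
  by have /(rmorph_root j) := px; rewrite -map_poly_comp (eq_map_poly iFK).
by move: px; rewrite -(eq_map_poly iFK) map_poly_comp fmorph_root.
Qed.

Lemma trace_unit x : trace_integral_closure iK j x -> ~ m (j x) -> unit_of B x.
Proof.
move=> x_int nmx; have int1 : trace_integral_closure iK j 1.
  by apply/trace_integralE; apply: integral1.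
have nm1 : ~ m (j 1).
  have -> : j 1 = val (1 : integral_ring iK) by rewrite !rmorph1.
  by move=> /red_m/eqP; rewrite rmorph1 oner_eq0.
split; first by exists x, 1; rewrite divr1.
exists x^-1; first by exists 1, x; rewrite div1r.
rewrite mulfV //; apply/eqP => x0; apply: nmx.
have -> : j x = val (0 : integral_ring iK) by rewrite x0 !rmorph0.
by apply/red_m; rewrite rmorph0.
Qed.

Lemma all_separable (y : F) : separable_element 1 y.
Proof.
apply/separable_elementP; have [p [p_monic _ py p_sep]] := hLsep.1 (j y).
exists (map_poly (in_alg F) p); split.
- by apply/polyOverP => i; rewrite coef_map /= rpredZ ?mem1v.
- move: py; rewrite -(eq_map_poly (f := j \o in_alg F)) //.
  by rewrite map_poly_comp fmorph_root.
- by rewrite separable_map.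
Qed.

Lemma adjoin_generator : exists theta : F, <<1; theta>>%VS = {:F}%VS.
Proof.
exists (separable_generator 1 {:F}); apply/esym/eq_adjoin_separable_generator.
  by apply/separableP => y _; apply: all_separable.
exact: sub1v.
Qed.

Lemma minPoly_splits (U : {subfield F}) (x : F) : exists2 rs : seq Lsep,
  map_poly j (minPoly U x) = \prod_(r <- rs) ('X - r%:P) & uniq rs.
Proof.
have sep : separable_poly (minPoly U x).
  by apply: dvdp_separable (all_separable x); apply/minPolyS/sub1v.
have [||rs mE] := @separable_splits _ (map_poly j (minPoly U x)) hLsep.2.
- by rewrite map_monic monic_minPoly.
- by rewrite separable_map.
by exists rs; rewrite // -separable_prod_XsubC -mE separable_map.
Qed.

Lemma conjugate_hom (x : F) (r : Lsep) : <<1; x>>%VS = {:F}%VS ->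
    root (map_poly j (minPoly 1 x)) r ->
  exists s : {rmorphism F -> Lsep}, (forall c, s c%:A = iL c) /\ s x = r.
Proof.
move=> x_gen mr; have [s [s1 sr]] := @adjoin_hom _ _ _ j 1%AS x x_gen r mr.
by exists s; split=> // c; rewrite s1 ?hj // rpredZ ?mem1v.
Qed.

Lemma hom_integral (s : {rmorphism F -> Lsep}) (x : F) : (forall c, s c%:A = iL c) ->
  integralOver iF x -> integralOver iK (s x).
Proof.
move=> sL [p p_monic px]; exists p => //; have /(rmorph_root s) := px.
by rewrite -map_poly_comp (eq_map_poly (g := iK)) // => a /=; rewrite sL.
Qed.

Lemma separating_element : exists eta : integral_ring iF,
  ~ m (j (val eta)) /\
  forall s : {rmorphism F -> Lsep}, (forall c, s c%:A = iL c) -> ~ s =1 j ->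
    ~ m (j (val eta) - s (val eta)).
Proof.
have [theta theta_gen] := adjoin_generator.
have theta_eq (s s' : {rmorphism F -> Lsep}) : (forall c, s c%:A = iL c) ->
    (forall c, s' c%:A = iL c) -> s theta = s' theta -> s =1 s'.
  move=> sL s'L; apply: (@eq_adjoin_hom _ _ _ 1%AS theta) => //.
  by move=> _ /vlineP[c ->]; rewrite sL s'L.
have [rs mE _] := minPoly_splits 1%AS theta.
(* The embeddings of [F] over [L] other than [j] correspond to these roots. *)
pose rs' := filter (predC1 (j theta)) rs.
have root_rs (s : {rmorphism F -> Lsep}) : (forall c, s c%:A = iL c) -> s theta \in rs.
  move=> sL; rewrite -root_prod_XsubC -mE.
  have /(rmorph_root s) := root_minPoly 1 theta; congr (root _ _).
  apply/polyP => i; rewrite !coef_map.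
  have /polyOverP/(_ i)/vlineP[c ->] := minPolyOver 1 theta.
  by rewrite /= sL hj.
have /choice[sigma sigmaP] (i : 'I_(size rs')) : exists s : {rmorphism F -> Lsep},
    (forall c, s c%:A = iL c) /\ s theta = tnth (in_tuple rs') i.
  have : tnth (in_tuple rs') i \in rs' by apply: mem_tnth.
  rewrite mem_filter => /andP[_]; rewrite -root_prod_XsubC -mE.
  exact: conjugate_hom.
have sigmaA i a : sigma i (iF a) = iK a by rewrite /= (sigmaP i).1.
have jA a : j (iF a) = iK a by rewrite /= hj.
have [|i|eta eta0 etaP] := @separating_hom_element A (integral_ring iF) kappa (integral_cst iF)
  (red \o integral_map jA) (@integral_ring_integral _ _ _) (size rs')
  (fun i => red \o integral_map (sigmaA i)).
- move=> i a /=; congr (red _); apply: val_inj => /=.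
  by rewrite (sigmaP i).1 hj.
(* If the two homomorphisms to [kappa] agreed, [sigma i] would be congruent to [j] and hence equal
   to it by rigidity, although it moves [theta] to another root. *)
- apply: contrapT => no_x.
  have : tnth (in_tuple rs') i \in rs' by apply: mem_tnth.
  rewrite mem_filter /= -(sigmaP i).2 => /andP[/eqP + _]; apply.
  pose iF0 : {rmorphism L -> F} := in_alg F.
  apply: (@inertia_rigid A (integral_ring iK) L Lsep kappa iA iL val red
    val_inj _ _ hLsep m F iF0 j (sigma i) _ hj (sigmaP i).1 hF) => [||u|x u w uE wE].
  + by move=> u; apply/integral_eltP/integral_valP.
  + by move=> z /integral_eltP z_mem; exists (IntegralElt z_mem).
  + by move=> /red_m.
  apply: contrapT => neq_uw; apply: no_x.
  have /integral_eltP x_mem : integralOver iF x.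
    by apply/trace_integralE; rewrite /trace_integral_closure /= -uE;
      apply/integral_eltP/integral_valP.
  exists (IntegralElt x_mem); apply: contra_not neq_uw => /= /esym.
  by congr (red _ = red _); apply: val_inj.
exists eta; split.
  have -> : j (val eta) = val (integral_map jA eta) by [].
  by move=> /red_m/eqP; apply/negP.
move=> s sL s_neq.
have : s theta \in rs'.
  rewrite mem_filter root_rs // andbT; apply/eqP => /(theta_eq _ _ sL hj).
  exact: s_neq.
case/(tnthP (in_tuple rs')) => i; rewrite -(sigmaP i).2 => /(theta_eq _ _ sL (sigmaP i).1) sE; rewrite sE.
have -> : j (val eta) - sigma i (val eta) =
    val (integral_map jA eta - integral_map (sigmaA i) eta) by rewrite rmorphB.
by move=> /red_m/eqP; rewrite rmorphB subr_eq0 eq_sym; exact/negP/etaP.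
Qed.

(** The ideal [m] is prime, being the kernel of a map to the field [kappa]. *)
Lemma prod_notin_ideal (rs : seq Lsep) :
    (forall x, x \in rs -> integralOver iK x /\ ~ m x) ->
  ~ m (\prod_(x <- rs) x).
Proof.
move=> rsP; suff [u <- /eqP u_neq0] : exists2 u : integral_ring iK,
    val u = \prod_(x <- rs) x & red u != 0 by move=> /red_m.
elim: rs rsP => [|x rs IHrs] rsP.
  by exists 1; rewrite ?big_nil ?rmorph1 // oner_neq0.
have [|u uE u_neq0] := IHrs; first by move=> y rs_y; apply: rsP; rewrite inE rs_y orbT.
have [/integral_eltP x_mem nmx] := rsP x (mem_head _ _).
exists (IntegralElt x_mem * u); first by rewrite big_cons -uE rmorphM.
by rewrite rmorphM mulf_neq0 //; apply/eqP => /red_m.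
Qed.

(** If L(eta) missed a generator [theta] of [F], the separable minimal polynomial of [theta] over
    L(eta) would have a second root. The embedding [s] belonging to it differs from [j] but agrees
    with it at [eta], and the difference 0 lies in [m]. *)
Lemma separating_generates (eta : F) :
    (forall s : {rmorphism F -> Lsep}, (forall c, s c%:A = iL c) -> ~ s =1 j ->
      ~ m (j eta - s eta)) ->
  <<1; eta>>%VS = {:F}%VS.
Proof.
move=> etaP; have [theta theta_gen] := adjoin_generator.
pose U := <<1; eta>>%AS.
have U_theta : <<U; theta>>%VS = {:F}%VS.
  by apply/eqP; rewrite eqEsubv subvf -theta_gen adjoinSl // sub1v.
have [/Fadjoin_idP <- //|nU] := boolP (theta \in U).
have [rs mE rs_uniq] := minPoly_splits U theta.
have sz_rs : (1 < size rs)%N.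
  rewrite -ltnS -(size_prod_XsubC rs id) -mE size_map_poly size_minPoly ltnS.
  by rewrite ltn_neqAle eq_sym adjoin_deg_eq1 nU.
have /hasP[r rs_r r_neq] : has (predC1 (j theta)) rs.
  apply: contraTT sz_rs; rewrite has_predC negbK -leqNgt => /all_pred1P rsE.
  by move: rs_uniq; rewrite rsE; case: (size rs) => [|[|n]] //=; rewrite inE eqxx.
have mr : root (map_poly j (minPoly U theta)) r by rewrite mE root_prod_XsubC.
have [s [sU sr]] := adjoin_hom U_theta mr.
have sL c : s c%:A = iL c by rewrite sU ?hj // rpredZ ?rpred1.
case: (etaP s sL).
  by move=> /(_ theta) sj; move: r_neq; rewrite /= -sr sj eqxx.
rewrite sU ?memv_adjoin // subrr.
have -> : 0 = val (0 : integral_ring iK) by rewrite rmorph0.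
by apply/red_m; rewrite rmorph0.
Qed.

(** The roots are conjugates of [eta], hence integral, and so are the coefficients; these lie in
    [L], thus in the integrally closed [A]. *)
Lemma integral_minPoly (eta : F) : integralOver iF eta -> <<1; eta>>%VS = {:F}%VS ->
  exists h : {poly A}, map_poly iF h = minPoly 1 eta.
Proof.
move=> eta_int eta_gen; have [rs mE _] := minPoly_splits 1%AS eta.
have rs_int r : r \in rs -> integralOver iK r.
  rewrite -root_prod_XsubC -mE => /(conjugate_hom eta_gen)[s [sL <-]].
  exact: hom_integral.
have /choice[a aE] i : exists a, iF a = (minPoly 1 eta)`_i.
  have /polyOverP/(_ i)/vlineP[c cE] := minPolyOver 1 eta.
  have [p p_monic pc] : integralOver iK (iL c).
    by rewrite -hj -[c%:A]cE -coef_map mE; apply: integral_coef_prod_XsubC.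
  have [|a aE] := hA_closed (x := c); last by exists a; rewrite cE aE.
  by exists p => //; move: pc; rewrite map_poly_comp fmorph_root.
exists (\poly_(i < size (minPoly 1 eta)) a i); apply/polyP => i.
rewrite coef_map coef_poly; case: ltnP => [_|le_i]; first exact: aE.
by rewrite nth_default //; exact: raddf0.
Qed.

Lemma inertial_generator : exists2 eta : F, B eta &
    [/\ <<1; eta>>%VS = {:F}%VS,
        exists h : {poly A}, map_poly iF h = minPoly 1 eta,
        unit_of B eta,
        unit_of B (minPoly 1 eta)^`().[eta]
      & henselian_element iF B eta].
Proof.
have [eta0 [eta_nm etaP]] := separating_element; set eta := val eta0 in eta_nm etaP.
have eta_int : integralOver iF eta by apply/integral_eltP/integral_valP.
have eta_gen := separating_generates etaP.
have [h hE] := integral_minPoly eta_int eta_gen.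
have eta_unit : unit_of B eta by apply: trace_unit => //; apply/trace_integralE.
have der_unit : unit_of B (minPoly 1 eta)^`().[eta].
  apply: trace_unit.
    apply/trace_integralE; rewrite -hE.
    have -> : (map_poly iF h)^`().[eta] = val (map_poly (integral_cst iF) h^`()).[eta0].
      by rewrite -horner_map -map_poly_comp deriv_map.
    exact/integral_eltP/integral_valP.
  rewrite -horner_map -deriv_map; have [rs mE rs_uniq] := minPoly_splits 1%AS eta.
  have rs_eta : j eta \in rs.
    by rewrite -root_prod_XsubC -mE; apply/rmorph_root/root_minPoly.
  (* Differentiating (X - j(eta)) g and evaluating at j(eta) leaves g(j(eta)), the product of the
     differences with the other roots. Each of these roots is s(eta) for some [s] distinct from [j],
     so no factor lies in [m]. *)
  rewrite mE (big_rem (j eta)) //= derivM derivXsubC mul1r hornerD hornerM hornerXsubC.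
  rewrite subrr mul0r addr0 horner_prod.
  rewrite -(big_map (fun r => ('X - r%:P).[j eta]) predT id).
  apply: prod_notin_ideal => _ /mapP[r + ->]; rewrite hornerXsubC.
  rewrite mem_rem_uniq // inE => /andP[r_neq].
  rewrite -root_prod_XsubC -mE => /(conjugate_hom eta_gen)[s [sL sr]].
  split; first by rewrite -sr; apply: integral_sub; apply: hom_integral.
  by rewrite -sr; apply: etaP => // sj; rewrite -sr sj eqxx in r_neq.
exists eta; first by case: eta_unit.
split=> //; first by exists h.
split; first by case: eta_unit.
by exists h; rewrite hE root_minPoly.
Qed.
End Main.

Theorem theorem1p2
  (A : idomainType) (L : fieldType) (iA : {rmorphism A -> L})
  (Lsep : fieldType) (iL : {rmorphism L -> Lsep})
  (m : set Lsep)
  (F : fieldExtType L) (j : {rmorphism F -> Lsep})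
  (hA_local : local_ring A)
  (hL : quotient_field iA)
  (hA_closed : integrally_closed iA)
  (hLsep : separable_closure iL)
  (hm : maximal_ideal_of (integral_closure (iL \o iA)) m)
  (hj : forall a : L, j (a%:A) = iL a)
  (hF : forall x : F, absolute_inertia_field iA iL m (j x)) :
  let B := localization_at_trace (iL \o iA) j m in
  exists2 eta : F, B eta &
    [/\ <<1; eta>>%VS = {:F}%VS,
        exists h : {poly A}, map_poly (in_alg F \o iA) h = minPoly 1 eta,
        unit_of B eta,
        unit_of B (minPoly 1 eta)^`().[eta]
      & henselian_element (in_alg F \o iA) B eta].
Proof.
have [kappa [red red_m]] := residue_of_maximal hm.
exact: (inertial_generator hA_closed hLsep hj hF red_m).
Qed.
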